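(* Let $\mathcal{A}$ be a Banach algebra having a bounded approximate identity. The following properties are equivalent: (i) Every continuous linear map $f:\mathcal{A}\to\mathcal{A}^{*}$ such that, for all $a,b\in\mathcal{A}$, $ab=0$ implies $f(a)\cdot b=0$, is a left multiplier. (ii) $\mathcal{A}$ is zero product determined. (iii) For every separating Banach $\mathcal{A}$-bimodule $\mathcal{M}$, every continuous linear map $f:\mathcal{A}\to\mathcal{M}$ such that, for all $a,b\in\mathcal{A}$, $ab=0$ implies $f(a)\cdot b=0$, is a left multiplier.
   Context: A Banach algebra $\mathcal{A}$ is zero product determined if for every continuous bilinear functional $\varphi:\mathcal{A}\times\mathcal{A}\to\mathbb{C}$ such that $\varphi(x,y)=0$ whenever $xy=0$, there is a continuous linear functional $\tau$ on $\mathcal{A}$ with $\varphi(x,y)=\tau(xy)$ for all $x,y\in\mathcal{A}$. The dual $\mathcal{A}^*$ is a Banach $\mathcal{A}$-bimodule in the usual way; in particular $(\xi\cdot b)(c)=\xi(bc)$ and $(b\cdot\xi)(c)=\xi(cb)$ for $\xi\in\mathcal{A}^*$, $b,c\in\mathcal{A}$. For a Banach $\mathcal{A}$-bimodule $\mathcal{M}$, a linear map $V:\mathcal{A}\to\mathcal{M}$ is a left multiplier if $V(ab)=V(a)\cdot b$ for all $a,b\in\mathcal{A}$. A Banach $\mathcal{A}$-bimodule $\mathcal{M}$ is separating if for every $m\in\mathcal{M}$: $\mathcal{A}\cdot m=\{0\}$ implies $m=0$, and $m\cdot\mathcal{A}=\{0\}$ implies $m=0$. *)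

(* Defs.v *)
From HB Require Import structures.
From mathcomp Require Import all_boot all_order all_algebra.
From mathcomp Require Import all_classical all_reals topology normedtype.
From mathcomp Require Import complex.

Set Implicit Arguments.
Unset Strict Implicit.
Unset Printing Implicit Defensive.

Import Order.TTheory GRing.Theory Num.Theory.
Import numFieldNormedType.Exports.

Local Open Scope classical_set_scope.
Local Open Scope ring_scope.

(* Not necessarily unital, hence not built on the ring structures. *)
HB.mixin Record isBanachAlgebra (K : numFieldType) A
    & CompleteNormedModule K A := {
  bmul : A -> A -> A;
  bmulA : associative bmul;
  bmulDl : forall a b c : A, bmul (a + b) c = bmul a c + bmul b c;
  bmulDr : forall a b c : A, bmul a (b + c) = bmul a b + bmul a c;
  bmulZl : forall (k : K) (a b : A), bmul (k *: a) b = k *: bmul a b;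
  bmulZr : forall (k : K) (a b : A), bmul a (k *: b) = k *: bmul a b;
  ler_norm_bmul : forall a b : A, `|bmul a b| <= `|a| * `|b|
}.

#[short(type="banachAlgType")]
HB.structure Definition BanachAlgebra (K : numFieldType) :=
  {A of CompleteNormedModule K A & isBanachAlgebra K A}.

(* The actions are bounded, not necessarily contractive; no unitality. *)
HB.mixin Record isBanachBimodule (K : numFieldType) (A : banachAlgType K) M
    & CompleteNormedModule K M := {
  lact : A -> M -> M;
  ract : M -> A -> M;
  lactDl : forall (a b : A) (m : M), lact (a + b) m = lact a m + lact b m;
  lactDr : forall (a : A) (m n : M), lact a (m + n) = lact a m + lact a n;
  lactZl : forall (k : K) (a : A) (m : M), lact (k *: a) m = k *: lact a m;
  lactZr : forall (k : K) (a : A) (m : M), lact a (k *: m) = k *: lact a m;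
  lactA : forall (a b : A) (m : M), lact a (lact b m) = lact (bmul a b) m;
  ractDl : forall (m n : M) (a : A), ract (m + n) a = ract m a + ract n a;
  ractDr : forall (m : M) (a b : A), ract m (a + b) = ract m a + ract m b;
  ractZl : forall (k : K) (m : M) (a : A), ract (k *: m) a = k *: ract m a;
  ractZr : forall (k : K) (m : M) (a : A), ract m (k *: a) = k *: ract m a;
  ractA : forall (m : M) (a b : A), ract (ract m a) b = ract m (bmul a b);
  lractA : forall (a : A) (m : M) (b : A),
    ract (lact a m) b = lact a (ract m b);
  lact_bounded : exists k : K, forall (a : A) (m : M),
    `|lact a m| <= k * (`|a| * `|m|);
  ract_bounded : exists k : K, forall (m : M) (a : A),
    `|ract m a| <= k * (`|m| * `|a|)
}.

#[short(type="banachBimodType")]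
HB.structure Definition BanachBimodule (K : numFieldType)
    (A : banachAlgType K) :=
  {M of CompleteNormedModule K M & isBanachBimodule K A M}.

Arguments lact {K A M} : rename.
Arguments ract {K A M} : rename.

Section Notions.
Variables (K : numFieldType) (A : banachAlgType K).

Definition net_tails (I : Type) (le : I -> I -> Prop) : set_system I :=
  [set S | exists i0, forall i, le i0 i -> S i].

Definition directed (I : Type) (le : I -> I -> Prop) : Prop :=
  [/\ inhabited I,
      forall i, le i i,
      forall i j k, le i j -> le j k -> le i k &
      forall i j, exists2 k, le i k & le j k].

Definition has_bounded_approximate_identity : Prop :=
  exists (I : Type) (le : I -> I -> Prop) (e : I -> A),
    [/\ directed le,
        exists c : K, forall i, `|e i| <= c,
        forall a : A, bmul (e i) a @[i --> net_tails le] --> a &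
        forall a : A, bmul a (e i) @[i --> net_tails le] --> a].

Definition left_multiplier (M : banachBimodType A) (V : A -> M) : Prop :=
  forall a b : A, V (bmul a b) = ract (V a) b.

Definition separating (M : banachBimodType A) : Prop :=
  forall m : M, ((forall a : A, lact a m = 0) -> m = 0) /\
                ((forall a : A, ract m a = 0) -> m = 0).

Lemma bmulr_continuous (b : A) : continuous (bmul ^~ b : A -> A).
Proof.
move=> x; apply/cvgrPdist_le => e e0.
have b1 : 0 < `|b| + 1 by rewrite ltr_wpDl ?normr_ge0 ?ltr01.
near=> y.
have -> : bmul x b - bmul y b = bmul (x - y) b.
  by rewrite bmulDl -[- y]scaleN1r bmulZl scaleN1r.
apply: le_trans (ler_norm_bmul _ _) _.
apply: (@le_trans _ _ (`|x - y| * (`|b| + 1))).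
  by rewrite ler_wpM2l// lerDl.
rewrite -ler_pdivlMr//.
by near: y; apply: cvgr_dist_le => //; rewrite divr_gt0.
Unshelve. all: by end_near. Qed.

Lemma bmull_continuous (b : A) : continuous (bmul b : A -> A).
Proof.
move=> x; apply/cvgrPdist_le => e e0.
have b1 : 0 < `|b| + 1 by rewrite ltr_wpDl ?normr_ge0 ?ltr01.
near=> y.
have -> : bmul b x - bmul b y = bmul b (x - y).
  by rewrite bmulDr -[- y]scaleN1r bmulZr scaleN1r.
apply: le_trans (ler_norm_bmul _ _) _; rewrite mulrC.
apply: (@le_trans _ _ (`|x - y| * (`|b| + 1))).
  by rewrite ler_wpM2l// lerDl.
rewrite -ler_pdivlMr//.
by near: y; apply: cvgr_dist_le => //; rewrite divr_gt0.
Unshelve. all: by end_near. Qed.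

End Notions.

Section ComplexComplete.
Variable R : realType.
Local Open Scope complex_scope.

Lemma complex_gt0E (e : R[i]) : 0 < e -> exists2 r : R, 0 < r & e = r%:C.
Proof.
case: e => a b; rewrite ltcE/= => /andP[/eqP -> a0].
by exists a.
Qed.

Lemma normc_Re_le (z : R[i]) : `|complex.Re z|%:C <= `|z|.
Proof.
rewrite normc_def lecR -sqrtr_sqr ler_wsqrtr//.
by rewrite lerDl sqr_ge0.
Qed.

Lemma normc_Im_le (z : R[i]) : `|complex.Im z|%:C <= `|z|.
Proof.
rewrite normc_def lecR -sqrtr_sqr ler_wsqrtr//.
by rewrite lerDr sqr_ge0.
Qed.

Lemma normc_le_ReIm (z : R[i]) :
  `|z| <= (`|complex.Re z| + `|complex.Im z|)%:C.
Proof.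
rewrite normc_def lecR -[leRHS]ger0_norm ?addr_ge0//.
rewrite -sqrtr_sqr ler_wsqrtr// sqrrD !real_normK ?num_real//.
by rewrite lerD2r lerDl mulrn_wge0// mulr_ge0.
Qed.

Lemma complex_complete (F : set_system (R[i])^o) :
  ProperFilter F -> cauchy F -> cvg F.
Proof.
move=> FF Fc.
have Fb (r : R) : 0 < r -> exists z, F (ball (z : R[i]^o) r%:C).
  move=> r0; have /cauchyP := Fc => /(_ r%:C).
  by rewrite ltcR => /(_ r0).
have proj (p : R[i] -> R) : (forall z, `|p z|%:C <= `|z|) ->
    (forall z w, p (z - w) = p z - p w) -> cvg (p @ F).
  move=> pn pB; apply: R_complete; apply/cauchyP => r r0.
  have [z Fz] := Fb _ r0; exists (p z).
  suff : F (fun w => `|p z - p w| < r) by [].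
  apply: filterS Fz => w; rewrite -ball_normE/= => zw.
  by rewrite -pB -ltcR (le_lt_trans (pn _)).
have /cvg_ex[/= a Fa] : cvg (complex.Re (R:=R) @ F).
  by apply: proj => [|[? ?] [? ?]//]; exact: normc_Re_le.
have /cvg_ex[/= b Fb'] : cvg (complex.Im (R:=R) @ F).
  by apply: proj => [|[? ?] [? ?]//]; exact: normc_Im_le.
apply/cvg_ex; exists (Complex a b); apply/cvgrPdist_le => e.
move=> /complex_gt0E[r r0 ->].
have r20 : 0 < r / 2 by rewrite divr_gt0.
near=> w.
apply: le_trans (normc_le_ReIm _) _; rewrite lecR [leRHS]splitr lerD//.
- have -> : complex.Re (Complex a b - w : R[i]) = a - complex.Re w.
    by case: (w) => ? ?.
  by near: w; move/cvgrPdist_le : Fa; apply.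
- have -> : complex.Im (Complex a b - w : R[i]) = b - complex.Im w.
    by case: (w) => ? ?.
  by near: w; move/cvgrPdist_le : Fb'; apply.
Unshelve. all: by end_near. Qed.

End ComplexComplete.

Section Dual.
Variables (R : realType) (A : normedModType R[i]).
Local Open Scope complex_scope.

Definition dual_pred : {pred A -> R[i]^o} :=
  fun f => `[< linear f /\ continuous f >].

Record dual := Dual { dual_fun :> A -> R[i]^o; _ : dual_fun \in dual_pred }.

HB.instance Definition _ := [isSub for dual_fun].
HB.instance Definition _ := [Choice of dual by <:].

Lemma dual_submod_closed : submod_closed dual_pred.
Proof.
split=> [|k f g].
  apply/asboolP; split; first by move=> k u v /=; rewrite scaler0 addr0.
  exact: cst_continuous.
move=> /asboolP[fl fc] /asboolP[gl gc]; apply/asboolP; split.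
  move=> l u v; rewrite !fctE fl gl !scalerDr !scalerA [k * l]mulrC.
  by rewrite addrACA.
move=> x; apply: cvgD; last exact: gc.
by apply: cvgZl_tmp; exact: fc.
Qed.

HB.instance Definition _ :=
  GRing.isSubmodClosed.Build R[i] (A -> R[i]^o) dual_pred dual_submod_closed.
HB.instance Definition _ := [SubChoice_isSubLmodule of dual by <:].

Lemma dual_linear (xi : dual) : linear xi.
Proof. by case: xi => f /= /asboolP[]. Qed.

HB.instance Definition _ (xi : dual) :=
  GRing.isLinear.Build R[i] A R[i]^o *:%R (dual_fun xi) (dual_linear xi).

Lemma dual_continuous (xi : dual) : continuous xi.
Proof. by case: xi => f /= /asboolP[]. Qed.

(* Norms over R[i] are valued in R[i], whence the real part before taking
   the supremum and the embedding back. *)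
Definition opnorm (xi : dual) : R :=
  sup [set complex.Re `|xi x| | x in [set x : A | `|x| <= 1]].

Definition dual_norm (xi : dual) : R[i] := (opnorm xi)%:C.

Lemma bounded_dual_pred (f : A -> R[i]^o) (M : R[i]) : 0 <= M -> linear f ->
  (forall x, `|f x| <= M * `|x|) -> f \in dual_pred.
Proof.
move=> M0 fl fM; apply/asboolP; split=> //.
pose fL := GRing.isLinear.Build R[i] A R[i]^o *:%R f fl.
pose f' : {linear A -> R[i]^o} := HB.pack f fL.
apply: (@bounded_linear_continuous _ _ _ f'); apply/linear_boundedP.
near=> r => x; apply: le_trans (fM x) _; rewrite ler_wpM2r//.
by near: r; apply: nbhs_pinfty_ge; rewrite ger0_real.
Unshelve. all: by end_near. Qed.

Lemma dual_bounded (xi : dual) :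
  exists2 M : R[i], 0 <= M & forall x, `|xi x| <= M * `|x|.
Proof.
have /continuous_linear_bounded : {for 0, continuous xi}.
  exact: dual_continuous.
move=> /(_ 0)/linear_boundedP/pinfty_ex_gt0[M M0 xiM].
by exists M => //; exact: ltW.
Qed.

Lemma opnorm_has_sup (xi : dual) :
  has_sup [set complex.Re `|xi x| | x in [set x : A | `|x| <= 1]].
Proof.
split.
  by exists (complex.Re `|xi 0|); exists 0 => //=; rewrite normr0 ler01.
have [M M0 xiM] := dual_bounded xi.
exists (complex.Re M) => _ [x /= x1 <-].
rewrite -lecR !RRe_real ?normr_real ?ger0_real//.
by apply: le_trans (xiM x) _; rewrite ler_piMr.
Qed.

Lemma le_dual_norm (xi : dual) (x : A) : `|xi x| <= dual_norm xi * `|x|.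
Proof.
have [->|x0] := eqVneq x 0; first by rewrite linear0 !normr0 mulr0.
rewrite -ler_pdivrMr ?normr_gt0// mulrC.
have -> : `|x|^-1 * `|xi x| = `|xi (`|x|^-1 *: x)|.
  by rewrite linearZ normrZ/= normfV normr_id.
rewrite -[leLHS]RRe_real ?normr_real// lecR; apply: sup_upper_bound; first exact: opnorm_has_sup.
by exists (`|x|^-1 *: x) => //=; rewrite normfZV.
Qed.

Lemma dual_norm_le (xi : dual) (M : R[i]) : 0 <= M ->
  (forall x, `|xi x| <= M * `|x|) -> dual_norm xi <= M.
Proof.
move=> M0 xiM; rewrite -(RRe_real (ger0_real M0)) lecR.
apply: ge_sup; first exact: (opnorm_has_sup xi).1.
move=> _ [x /= x1 <-].
rewrite -lecR !RRe_real ?normr_real ?ger0_real//.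
by apply: le_trans (xiM x) _; rewrite ler_piMr.
Qed.

Lemma dual_norm_ge0 (xi : dual) : 0 <= dual_norm xi.
Proof.
rewrite lecR; apply: le_trans (_ : complex.Re `|xi 0| <= _).
  by rewrite linear0 normr0.
apply: sup_upper_bound; first exact: opnorm_has_sup.
by exists 0 => //=; rewrite normr0 ler01.
Qed.

Lemma ler_dual_normD (xi zeta : dual) :
  dual_norm (xi + zeta) <= dual_norm xi + dual_norm zeta.
Proof.
apply: dual_norm_le => [|x]; first by rewrite addr_ge0 ?dual_norm_ge0.
apply: le_trans (ler_normD _ _) _.
by rewrite mulrDl lerD ?le_dual_norm.
Qed.

Let ler_dual_normZ (k : R[i]) (xi : dual) :
  dual_norm (k *: xi) <= `|k| * dual_norm xi.
Proof.
apply: dual_norm_le => [|x]; first by rewrite mulr_ge0 ?dual_norm_ge0.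
by rewrite normrZ -mulrA ler_wpM2l ?le_dual_norm.
Qed.

Lemma dual_normZ (k : R[i]) (xi : dual) :
  dual_norm (k *: xi) = `|k| * dual_norm xi.
Proof.
apply/le_anti/andP; split; first exact: ler_dual_normZ.
have [->|k0] := eqVneq k 0; first by rewrite normr0 mul0r dual_norm_ge0.
rewrite mulrC -ler_pdivlMr ?normr_gt0// mulrC -normfV.
by rewrite -[in leLHS](scalerK k0 xi) ler_dual_normZ.
Qed.

Lemma dual_norm_eq0 (xi : dual) : dual_norm xi = 0 -> xi = 0.
Proof.
move=> xi0; apply: val_inj; apply/funext => x.
by apply/normr0_eq0/le_anti; rewrite normr_ge0 andbT -(mul0r `|x|) -xi0
  le_dual_norm.
Qed.

HB.instance Definition _ := Lmodule_isNormed.Build R[i] dual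
  ler_dual_normD dual_normZ dual_norm_eq0.

Lemma dual_normE (xi : dual) : `|xi| = dual_norm xi. Proof. by []. Qed.

Lemma dual_complete (F : set_system dual) :
  ProperFilter F -> cauchy F -> cvg F.
Proof.
move=> FF Fc.
have Fe (e : R[i]) : 0 < e -> exists xi : dual, F (fun zeta => `|xi - zeta| < e).
  move=> e0; have /cauchyP/(_ e e0)[xi Fxi] := Fc; exists xi.
  by apply: filterS Fxi => zeta; rewrite -ball_normE.
have pt x : cvg ((fun xi : dual => (xi x : R[i]^o)) @ F).
  apply: complex_complete; apply/cauchyP => e e0.
  have x1 : 0 < `|x| + 1 by rewrite ltr_wpDl ?normr_ge0 ?ltr01.
  have [|xi Fxi] := Fe (e / (`|x| + 1)); first by rewrite divr_gt0.
  exists (xi x).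
  suff : F (fun zeta : dual => `|xi x - zeta x| < e) by rewrite -ball_normE.
  apply: filterS Fxi => zeta; rewrite ltr_pdivlMr//.
  apply: le_lt_trans; apply: le_trans (le_dual_norm (xi - zeta) x) _.
  by rewrite -dual_normE ler_wpM2l// lerDl.
pose g x : R[i]^o := lim ((fun xi : dual => (xi x : R[i]^o)) @ F).
have gE x : (fun xi : dual => (xi x : R[i]^o)) @ F --> g x by exact: pt.
have gl : linear g.
  move=> k x y; apply: cvg_lim; first exact: norm_hausdorff.
  have -> : (fun xi : dual => (xi (k *: x + y) : R[i]^o)) =
            (fun xi : dual => k *: (xi x : R[i]^o) + xi y).
    by apply/funext => xi; rewrite linearP.
  by apply: cvgD; [apply: cvgZl_tmp|]; exact: gE.
have gB (xi : dual) e x : F (fun zeta => `|xi - zeta| < e) ->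
    `|xi x - g x| <= e * `|x|.
  move=> Fxi; apply/ler_addgt0Pr => d d0.
  have : F (fun zeta : dual => `|xi x - g x| <= e * `|x| + d).
    have Fd : F (fun zeta : dual => `|g x - zeta x| <= d).
      by have /cvgrPdist_le := gE x; apply.
    near=> zeta.
    rewrite -(subrKA (zeta x)) (le_trans (ler_normD _ _))// lerD//.
      apply: le_trans (le_dual_norm (xi - zeta) x) _.
      by rewrite ler_wpM2r// -dual_normE ltW//; near: zeta.
    by rewrite distrC; near: zeta.
  by move=> /filter_ex[].
have [xi1 Fxi1] := Fe 1 ltr01.
have gd : g \in dual_pred.
  apply: (@bounded_dual_pred g (dual_norm xi1 + 1)) => // [|x].
    by rewrite addr_ge0 ?dual_norm_ge0.
  rewrite -[g x](subrK (xi1 x)) addrC (le_trans (ler_normD _ _))// mulrDl.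
  by rewrite lerD ?le_dual_norm// distrC gB.
apply/cvg_ex; exists (Dual gd : dual); apply/cvgrPdist_le => e e0.
have e20 : 0 < e / 2 by rewrite divr_gt0.
have [xi Fxi] := Fe _ e20.
near=> zeta.
rewrite -(subrKA xi) (le_trans (ler_normD _ _))// [leRHS]splitr lerD//.
  by rewrite distrC dual_norm_le// ?ltW// => x; exact: gB.
by rewrite ltW//; near: zeta.
Unshelve. all: by end_near. Qed.

HB.instance Definition _ := Uniform_isComplete.Build dual dual_complete.

End Dual.

Section DualBimodule.
Variables (R : realType) (A : banachAlgType R[i]).

Lemma dual_lact_subproof (b : A) (xi : dual A) :
  (fun c => xi (bmul c b)) \in @dual_pred R A.
Proof.
apply/asboolP; split=> [k u v|x]; first by rewrite bmulDl bmulZl linearP.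
apply: (@continuous_comp _ _ _ (bmul ^~ b) xi).
  exact: bmulr_continuous.
exact: dual_continuous.
Qed.

Lemma dual_ract_subproof (xi : dual A) (b : A) :
  (fun c => xi (bmul b c)) \in @dual_pred R A.
Proof.
apply/asboolP; split=> [k u v|x]; first by rewrite bmulDr bmulZr linearP.
apply: (@continuous_comp _ _ _ (bmul b) xi).
  exact: bmull_continuous.
exact: dual_continuous.
Qed.

Definition dual_lact (b : A) (xi : dual A) : dual A :=
  Dual (dual_lact_subproof b xi).

Definition dual_ract (xi : dual A) (b : A) : dual A :=
  Dual (dual_ract_subproof xi b).

Let dualP (xi zeta : dual A) : (forall c, xi c = zeta c) -> xi = zeta.
Proof. by move=> h; apply: val_inj; apply/funext. Qed.

Lemma dual_lact_bounded : exists k : R[i], forall (a : A) (m : dual A),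
  `|dual_lact a m| <= k * (`|a| * `|m|).
Proof.
exists 1 => a xi; rewrite mul1r; apply: dual_norm_le => [|x].
  by rewrite mulr_ge0.
apply: le_trans (le_dual_norm xi _) _.
rewrite -dual_normE [`|a| * _]mulrC -mulrA ler_wpM2l//.
by rewrite mulrC ler_norm_bmul.
Qed.

Lemma dual_ract_bounded : exists k : R[i], forall (m : dual A) (a : A),
  `|dual_ract m a| <= k * (`|m| * `|a|).
Proof.
exists 1 => xi a; rewrite mul1r; apply: dual_norm_le => [|x].
  by rewrite mulr_ge0.
apply: le_trans (le_dual_norm xi _) _.
by rewrite -dual_normE -mulrA ler_wpM2l// ler_norm_bmul.
Qed.

Lemma dual_lactDl (a b : A) (m : dual A) :
  dual_lact (a + b) m = dual_lact a m + dual_lact b m.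
Proof. by apply: dualP => c; rewrite /= bmulDr linearD. Qed.

Lemma dual_lactDr (a : A) (m n : dual A) :
  dual_lact a (m + n) = dual_lact a m + dual_lact a n.
Proof. exact: dualP. Qed.

Lemma dual_lactZl (k : R[i]) (a : A) (m : dual A) :
  dual_lact (k *: a) m = k *: dual_lact a m.
Proof. by apply: dualP => c; rewrite /= bmulZr linearZ. Qed.

Lemma dual_lactZr (k : R[i]) (a : A) (m : dual A) :
  dual_lact a (k *: m) = k *: dual_lact a m.
Proof. exact: dualP. Qed.

Lemma dual_lactA (a b : A) (m : dual A) :
  dual_lact a (dual_lact b m) = dual_lact (bmul a b) m.
Proof. by apply: dualP => c; rewrite /= bmulA. Qed.

Lemma dual_ractDl (m n : dual A) (a : A) :
  dual_ract (m + n) a = dual_ract m a + dual_ract n a.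
Proof. exact: dualP. Qed.

Lemma dual_ractDr (m : dual A) (a b : A) :
  dual_ract m (a + b) = dual_ract m a + dual_ract m b.
Proof. by apply: dualP => c; rewrite /= bmulDl linearD. Qed.

Lemma dual_ractZl (k : R[i]) (m : dual A) (a : A) :
  dual_ract (k *: m) a = k *: dual_ract m a.
Proof. exact: dualP. Qed.

Lemma dual_ractZr (k : R[i]) (m : dual A) (a : A) :
  dual_ract m (k *: a) = k *: dual_ract m a.
Proof. by apply: dualP => c; rewrite /= bmulZl linearZ. Qed.

Lemma dual_ractA (m : dual A) (a b : A) :
  dual_ract (dual_ract m a) b = dual_ract m (bmul a b).
Proof. by apply: dualP => c; rewrite /= bmulA. Qed.

Lemma dual_lractA (a : A) (m : dual A) (b : A) :
  dual_ract (dual_lact a m) b = dual_lact a (dual_ract m b).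
Proof. by apply: dualP => c; rewrite /= bmulA. Qed.

HB.instance Definition _ := isBanachBimodule.Build R[i] A (dual A)
  dual_lactDl dual_lactDr dual_lactZl dual_lactZr dual_lactA
  dual_ractDl dual_ractDr dual_ractZl dual_ractZr dual_ractA
  dual_lractA dual_lact_bounded dual_ract_bounded.

Lemma dual_lactE (b : A) (xi : dual A) (c : A) :
  lact b xi c = xi (bmul c b).
Proof. by []. Qed.

Lemma dual_ractE (xi : dual A) (b c : A) :
  ract xi b c = xi (bmul b c).
Proof. by []. Qed.

Definition zero_product_determined : Prop :=
  forall phi : {bilinear A -> A -> R[i]^o},
    continuous (fun p : A * A => phi p.1 p.2) ->
    (forall x y : A, bmul x y = 0 -> phi x y = 0) ->
    exists tau : dual A, forall x y : A, phi x y = tau (bmul x y).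

End DualBimodule.

(* Main.v *)
Require Import Defs.
From HB Require Import structures.
From mathcomp Require Import all_boot all_order all_algebra.
From mathcomp Require Import all_classical all_reals topology normedtype.
From mathcomp Require Import complex lra derive.

Set Implicit Arguments.
Unset Strict Implicit.
Unset Printing Implicit Defensive.

Import Order.TTheory GRing.Theory Num.Theory.
Import numFieldNormedType.Exports.

Local Open Scope classical_set_scope.
Local Open Scope ring_scope.

(** A bilinear functional phi on A and a linear map f from A to its dual are
the same thing, through f a = phi a _.  If phi vanishes on the pairs with zero
product, then so does f a . b, because a b = 0 forces a (b c) = 0 for every c.
Once such an f is known to be a left multiplier, phi (a b) c = phi a (b c), and
phi is recovered from the bounded approximate identity e: the functionals
phi (e i) are bounded uniformly in i and converge on every product,
phi (e i) (a b) = phi (e i a) b --> phi a b.  Products are dense in A, as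
x e_i --> x, so the net converges at every point to a continuous functional
tau, and phi a b = tau (a b)
([cvg_dual_of_dense], [zero_product_determined_of_dual]).

Conversely, let A be zero product determined and f : A -> M annihilate zero
products.  Each continuous functional xi on M turns f into the scalar form
xi (f a . b), which is therefore tau (a b) for some tau; then both
xi (f (a b) . c) and xi (f a . (b c)) are tau (a b c).  As xi is arbitrary,
the continuous functionals separate the points of M, and M is separating,
f (a b) = f a . b ([zero_product_determined_multiplier]).

The dual of A is itself a separating bimodule, since xi c is a limit both of
xi (c e_i) and of xi (e_i c) ([dual_separating]); this closes the cycle.

That functionals separate points is the Hahn-Banach theorem.  It is obtained
here from minimal sublinear functionals: one exists below any sublinear p by
Zorn's lemma, and it has to be linear because [sublinear_tilt] would otherwise
produce a smaller one.  The complex case follows by taking u x - i u (i x) for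
a real functional u. *)

(** * The Hahn-Banach theorem by minimal sublinear functionals *)

Definition sublinear (R : realType) (V : lmodType R) (p : V -> R) : Prop :=
  (forall x y, p (x + y) <= p x + p y) /\
  (forall r x, 0 <= r -> p (r *: x) <= r * p x).

Section Sublinear.
Context {R : realType} {V : lmodType R}.
Implicit Types p : V -> R.

(** The lower bound that makes every infimum below finite: it bounds a whole
family from below as soon as the family is bounded above at [- x]. *)
Lemma sublinear_geN p (x : V) : sublinear p -> - p (- x) <= p x.
Proof.
move=> [pD pZ]; have := pD x (- x); rewrite subrr.
have := pD 0 0; rewrite addr0.
by lra.
Qed.

Lemma sublinearZ p (r : R) (x : V) : sublinear p -> 0 <= r ->
  p (r *: x) = r * p x.
Proof.
move=> [pD pZ]; rewrite le_eqVlt => /predU1P[<-|r0].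
  have := pD 0 0; have := pZ 0 0 (lexx 0).
  by rewrite addr0 !scale0r !mul0r; lra.
apply/le_anti; rewrite (pZ _ _ (ltW r0))/= -ler_pdivlMl//.
have rn0 : r != 0 by rewrite gt_eqF.
by rewrite -[x in leLHS](scalerK rn0) pZ// invr_ge0 ltW.
Qed.

(** Sublinearity passes to a pointwise infimum even when the members are not
sublinear one by one: it is enough that each inequality can be met by moving to
another index.  This covers both the infimum of a chain and that of a family of
translates. *)
Lemma sublinear_inf (I : Type) (F : I -> V -> R) (m : V -> R) : inhabited I ->
  (forall i x, m x <= F i x) ->
  (forall i j x y, exists k, F k (x + y) <= F i x + F j y) ->
  (forall i r x, 0 <= r -> exists k, F k (r *: x) <= r * F i x) ->
  sublinear (fun x => inf [set F i x | i in [set: I]]).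
Proof.
move=> [i0] mF FD FZ.
have ubI i x : inf [set F i x | i in [set: I]] <= F i x.
  by apply: ge_inf; [exists (m x) => _ [j _ <-] | exists i].
have glb c x : (forall i, c <= F i x) -> c <= inf [set F i x | i in [set: I]].
  by move=> cF; apply: lb_le_inf => [|_ [j _ <-]//]; exists (F i0 x), i0.
split=> [x y|r x r0].
  rewrite -lerBlDr; apply: (glb) => i; rewrite lerBlDr [leRHS]addrC -lerBlDr.
  apply: (glb) => j; rewrite lerBlDr [leRHS]addrC; have [k] := FD i j x y.
  exact: le_trans.
have leF i : inf [set F i (r *: x) | i in [set: I]] <= r * F i x.
  by have [k] := FZ i r x r0; apply: le_trans.
move: r0; rewrite le_eqVlt => /predU1P[r0|r0].
  by have := leF i0; rewrite -r0 !mul0r.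
by rewrite mulrC -ler_pdivrMr//; apply: (glb) => i; rewrite ler_pdivrMr// mulrC.
Qed.

(** Zorn's lemma for the reversed pointwise order on the sublinear functionals
below [p].  The infimum of a chain is a bound for it: of two members the smaller
one witnesses subadditivity. *)
Lemma exists_minimal_sublinear p : sublinear p ->
  exists2 q, sublinear q /\ (forall x, q x <= p x) &
    forall q', sublinear q' -> (forall x, q' x <= q x) -> q' = q.
Proof.
move=> sp.
pose T := {q : V -> R | sublinear q /\ forall x, q x <= p x}.
have pT : sublinear p /\ forall x, p x <= p x by split.
pose le (q1 q2 : T) := `[< forall x, sval q2 x <= sval q1 x >].
have leq (q1 q2 : T) x : le q1 q2 -> sval q2 x <= sval q1 x.
  by move=> /asboolP.
have [||||q qmin] := @Zorn T le.
- by move=> q; apply/asboolP.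
- move=> q1 q2 q3 q12 q23; apply/asboolP => x.
  by rewrite (le_trans (leq _ _ _ q23))// leq.
- move=> [q1 h1] [q2 h2] q12 q21; apply: eq_exist.
  by apply/funext => x; apply/le_anti; rewrite (leq _ _ _ q12) (leq _ _ _ q21).
- move=> C Ctot.
  (* The infimum over an empty chain is meaningless; [p] bounds that chain. *)
  have [[q0 Cq0]|C0] := pselect (exists q : T, C q); last first.
    by exists (exist _ p pT) => q Cq; case: C0; exists q.
  pose F (q : {q | C q}) : V -> R := sval (sval q).
  have mF (q : {q | C q}) x : - p (- x) <= F q x.
    have [sq qp] := svalP (sval q).
    by rewrite (le_trans _ (sublinear_geN x sq))// lerN2.
  have sI : sublinear (fun x => inf [set F i x | i in [set: {q | C q}]]).
    apply: (sublinear_inf (m := fun x => - p (- x))) => //.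
    + by split; exists q0.
    + move=> [q1 C1] [q2 C2] x y; rewrite /F/=.
      have [/leq h|/leq h] := Ctot _ _ C1 C2.
        exists (exist _ q2 C2); have [[qD _] _] := svalP q2.
        by rewrite (le_trans (qD _ _))// lerD2r.
      exists (exist _ q1 C1); have [[qD _] _] := svalP q1.
      by rewrite (le_trans (qD _ _))// lerD2l.
    + move=> [q C1] r x r0; exists (exist _ q C1).
      by have [[_ qZ] _] := svalP q; apply: qZ.
  have leI (q : T) : C q -> forall x,
      inf [set F i x | i in [set: {q | C q}]] <= sval q x.
    move=> Cq x; apply: ge_inf; last by exists (exist _ q Cq).
    by exists (- p (- x)) => _ [j _ <-].
  have Ip x : inf [set F i x | i in [set: {q | C q}]] <= p x.
    by rewrite (le_trans (leI _ Cq0 x))//; case: (svalP q0).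
  pose below_p (q : V -> R) := sublinear q /\ forall x, q x <= p x.
  exists (exist below_p _ (conj sI Ip)) => q Cq.
  by apply/asboolP => x; apply: leI.
have [sq qp] := svalP q.
exists (sval q) => // q' sq' q'q.
have q'p x : q' x <= p x by rewrite (le_trans (q'q x)).
pose t : T := exist _ q' (conj sq' q'p).
by rewrite -[q']/(sval t) (qmin t)//; apply/asboolP.
Qed.

(** Lowering [p] as much as its slope along [a] allows, to the infimum over
[t >= 0] of [p (x + t *: a) - t * p a], makes it additive on the line through
[a]: the value at [- a] drops to [- p a], and by [sublinear_geN] no sublinear
functional that agrees with [p] at [a] can go lower. *)
Lemma sublinear_tilt p (a : V) : sublinear p ->
  exists2 q, sublinear q & (forall x, q x <= p x) /\ q (- a) <= - p a.
Proof.
move=> sp; have [pD pZ] := sp.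
pose I := {t : R | 0 <= t}.
pose F (t : I) x := p (x + sval t *: a) - sval t * p a.
have mF (t : I) x : - p (- x) <= F t x.
  rewrite /F; have := pD (x + sval t *: a) (- x).
  by rewrite addrAC subrr add0r (sublinearZ _ sp) ?(svalP t)//; lra.
have inf_le x t (t0 : 0 <= t) :
    inf [set F i x | i in [set: I]] <= p (x + t *: a) - t * p a.
  by apply: ge_inf; [exists (- p (- x)) => _ [j _ <-] | exists (exist _ t t0)].
exists (fun x => inf [set F i x | i in [set: I]]).
  apply: (sublinear_inf (m := fun x => - p (- x))) => //.
  - by split; exists 0.
  - move=> [s s0] [t t0] x y; exists (exist _ (s + t) (addr_ge0 s0 t0)).
    rewrite /F/=; have := pD (x + s *: a) (y + t *: a).
    by rewrite addrACA -scalerDl; lra.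
  - move=> [t t0] r x r0; exists (exist _ (r * t) (mulr_ge0 r0 t0)).
    rewrite /F/= -scalerA -scalerDr mulrBr mulrA lerD2r.
    exact: pZ.
split=> [x|].
  by apply: le_trans (inf_le x 0 (lexx 0)) _; rewrite scale0r addr0 mul0r subr0.
(* At [- a] the parameter [t = 1] gives [p 0 - p a]. *)
apply: le_trans (inf_le _ 1 ler01) _.
by have := pZ 0 0 (lexx 0); rewrite scale1r addNr mul1r scale0r mul0r; lra.
Qed.

(** Tilting a minimal [u] does not change it, so [u (- x) <= - u x] for every
[x]; an odd sublinear functional is linear.  Starting from [p] tilted at [a]
forces [u (- a) <= - p a], hence equality at [a]. *)
Lemma hahn_banach p (a : V) : sublinear p ->
  exists2 u : V -> R, linear (u : V -> R^o) &
    (forall x, u x <= p x) /\ u a = p a.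
Proof.
move=> sp; have [q sq [qp qa]] := sublinear_tilt a sp.
have [u [su uq] umin] := exists_minimal_sublinear sq.
have uN x : u (- x) = - u x.
  have [v sv [vu]] := sublinear_tilt x su.
  rewrite (umin v)// => ux; apply/le_anti; rewrite ux/=.
  by rewrite lerNl sublinear_geN.
have uZ r x : u (r *: x) = r * u x.
  have [r0|r0] := leP 0 r; first exact: sublinearZ.
  by rewrite -[r]opprK scaleNr uN sublinearZ ?mulNr// oppr_ge0 ltW.
have [uD _] := su.
exists u; last first.
  split=> [x|]; first by rewrite (le_trans (uq x)).
  apply/le_anti; rewrite (le_trans (uq a))//=.
  by rewrite -lerN2 -uN (le_trans (uq _)).
move=> r x y; rewrite -[RHS]/(r * u x + u y) -uZ.
apply/le_anti; rewrite uD/=.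
by have := uD (r *: x + y) (- y); rewrite addrK uN; lra.
Qed.
End Sublinear.

(** * Continuous functionals on complex normed spaces *)

Section RealSpace.
Context {R : realType}.
Local Open Scope complex_scope.

(** The real vector space underlying a complex one, under a name of its own so
that it can carry a second scalar multiplication. *)
Definition real_space (M : lmodType R[i]) : Type := M.

HB.instance Definition _ (M : lmodType R[i]) := GRing.Zmodule.on (real_space M).

Section Scale.
Variable M : lmodType R[i].
Let scale (r : R) (x : real_space M) : real_space M := r%:C *: (x : M).

Let scaleA r s x : scale r (scale s x) = scale (r * s) x.
Proof. by rewrite /scale scalerA -rmorphM. Qed.

Let scale1 : left_id 1 scale.
Proof. by move=> x; rewrite /scale rmorph1 scale1r. Qed.

Let scaleDr : right_distributive scale +%R.
Proof. by move=> r x y; exact: scalerDr. Qed.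

Let scaleDl x : {morph scale^~ x : r s / r + s}.
Proof. by move=> r s; rewrite /scale rmorphD scalerDl. Qed.

HB.instance Definition _ := GRing.Zmodule_isLmodule.Build R (real_space M)
  scaleA scale1 scaleDr scaleDl.
End Scale.

Lemma real_spaceZE (M : lmodType R[i]) (r : R) (x : real_space M) :
  r *: x = r%:C *: (x : M).
Proof. by []. Qed.

(** Hahn-Banach for the norm, seen as a sublinear functional on the underlying
real space, gives a real-linear [u] with [u m = `|m|]; the complex-linear
functional with real part [u] is nonzero at [m] as soon as [m] is. *)
Lemma dual_separates_points (M : normedModType R[i]) (m : M) :
  (forall xi : dual M, xi m = 0) -> m = 0.
Proof.
move=> xim0.
pose p (x : real_space M) : R := complex.Re `|x : M|.
have pE x : (p x)%:C = `|x : M| by rewrite RRe_real ?normr_real.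
have sp : sublinear p.
  split=> [x y|r x r0]; rewrite -lecR.
    by rewrite rmorphD/= !pE ler_normD.
  by rewrite rmorphM/= !pE real_spaceZE normrZ ger0_norm ?lecR.
have [u ul [up um]] := @hahn_banach R (real_space M) p m sp.
have uD x y : u (x + y) = u x + u y.
  by have := ul 1 x y; rewrite !scale1r.
have u0 : u 0 = 0 by have := uD 0 0; rewrite addr0; lra.
have uZ r x : u (r%:C *: (x : M)) = r * u x.
  by have := ul r x 0; rewrite !addr0 u0 addr0.
have uN x : u (- x) = - u x by have := uD x (- x); rewrite subrr u0; lra.
have u_le x : `|u x| <= p x.
  rewrite ler_norml up andbT lerNl -uN (le_trans (up _))//.
  by rewrite -lecR !pE normrN.
pose f (x : M) : R[i]^o := Complex (u x) (- u ('i *: x)).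
(* Reduces complex scalars to real ones and to multiplication by ['i]. *)
have kE (k : R[i]) (x : M) : k *: x =
    (complex.Re k)%:C *: x + (complex.Im k)%:C *: ('i *: x).
  by rewrite scalerA -scalerDl [_ * 'i]mulrC -complexE.
have fl : linear f.
  move=> k x y; rewrite /f scalerDr !uD.
  have -> : 'i *: (k *: x) =
      (complex.Re k)%:C *: ('i *: x) - (complex.Im k)%:C *: x.
    rewrite [k *: x]kE scalerDr !scalerA; congr (_ *: _ + _).
      exact: mulrC.
    rewrite -scaleNr; congr (_ *: _).
    by rewrite mulrAC -expr2 sqr_i mulN1r.
  rewrite [k *: x]kE !uD uN !uZ; case: k => a b /=.
  by apply/eqP; rewrite eq_complex/=; apply/andP; split; apply/eqP; lra.
have normi : `|'i : R[i]| = 1 by rewrite normc_def/= expr0n expr1n add0r sqrtr1.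
have fb x : `|f x| <= 2 * `|x|.
  rewrite (le_trans (normc_le_ReIm _))//= rmorphD/= normrN.
  rewrite mulr_natl mulr2n lerD//; first by rewrite -pE lecR.
  by rewrite -[`|x|]mul1r -normi -normrZ -pE lecR.
have fd : f \in @dual_pred R M by apply: bounded_dual_pred fl fb.
have /(congr1 (@complex.Re R))/= := xim0 (Dual fd).
rewrite um => /(congr1 (fun r : R => r%:C)).
by rewrite pE => /normr0_eq0.
Qed.
End RealSpace.

(** Uniform boundedness makes the net Cauchy at every point once it converges
on a dense set; the pointwise limit inherits linearity and the bound. *)
Lemma cvg_dual_of_dense (R : realType) (V : normedModType R[i]) (I : Type)
    (F : set_system I) (g : I -> dual V) (C : R[i]) (D : set V) :
  ProperFilter F -> (forall i, `|g i| <= C) ->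
  (forall x e, 0 < e -> exists2 y, D y & `|x - y| < e) ->
  (forall y, D y -> cvg (g i y @[i --> F])) ->
  exists tau : dual V, forall x, g i x @[i --> F] --> tau x.
Proof.
move=> FF gC Ddense Dcvg.
have [i0 _] := filter_ex (@filterT _ F _).
have C0 : 0 <= C by rewrite (le_trans _ (gC i0)).
have gCx i x : `|g i x| <= C * `|x|.
  by rewrite (le_trans (le_dual_norm _ _))// ler_wpM2r// gC.
have gcvg x : cvg (g i x @[i --> F]).
  apply: complex_complete; apply/cauchyP => e e0.
  have e20 : 0 < e / 2 by rewrite divr_gt0.
  have C1 : 0 < C + 1 by rewrite ltr_wpDl.
  have [|y Dy xy] := Ddense x (e / 2 / (C + 1)); first by rewrite divr_gt0.
  have /cvg_ex[/= l gl] := Dcvg y Dy; exists l.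
  suff : \forall i \near F, `|l - g i x| < e by rewrite -ball_normE.
  near=> i.
  have -> : l - g i x = (l - g i y) + g i (y - x) by rewrite linearB/= subrKA.
  rewrite (le_lt_trans (ler_normD _ _))// [ltRHS]splitr ltr_leD//.
    by near: i; move/cvgrPdist_lt: gl; apply.
  rewrite (le_trans (gCx _ _))// distrC.
  move: (ltW xy); rewrite ler_pdivlMr// mulrC; apply: le_trans.
  by rewrite ler_wpM2r// lerDl.
pose t x : R[i]^o := lim (g i x @[i --> F]).
have tE x : g i x @[i --> F] --> t x by exact: gcvg.
have tl : linear t.
  move=> k x y; apply: cvg_lim; first exact: norm_hausdorff.
  under eq_cvg do rewrite linearP.
  by apply: cvgD; [apply: cvgZl_tmp|]; exact: tE.
have tC x : `|t x| <= C * `|x|.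
  apply/ler_addgt0Pr => e e0; have [j] : exists i, `|t x - g i x| <= e.
    by apply: (@filter_ex _ F); move/cvgrPdist_le: (tE x); apply.
  move=> tj; rewrite -[t x](subrK (g j x)) (le_trans (ler_normD _ _))//.
  by rewrite addrC lerD.
by exists (Dual (bounded_dual_pred C0 tl tC)).
Unshelve. all: by end_near. Qed.

(** Evaluation at [x] is itself a bounded functional, an element of the
bidual. *)
Lemma dual_eval_continuous (R : realType) (V : normedModType R[i]) (x : V) :
  continuous (fun xi : dual V => xi x).
Proof.
have /asboolP[] // : (fun xi : dual V => xi x) \in @dual_pred R (dual V).
apply: (@bounded_dual_pred _ _ _ `|x|) => // xi.
by rewrite mulrC; exact: le_dual_norm.
Qed.

Lemma bounded_bilinear_continuous (K : numFieldType) (U V W : normedModType K)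
  (f : {bilinear U -> V -> W}) (k : K) : 0 <= k ->
  (forall u v, `|f u v| <= k * `|u| * `|v|) ->
  continuous (fun p : U * V => f p.1 p.2).
Proof.
move=> k0 fk [u v]; apply/cvgrPdist_le => e e0 /=.
have d1 : 0 < k * (`|v| + 1) + 1 by rewrite ltr_wpDl// mulr_ge0// addr_ge0.
have d2 : 0 < k * `|u| + 1 by rewrite ltr_wpDl// mulr_ge0.
near=> p.
have -> : f u v - f p.1 p.2 = f (u - p.1) p.2 + f u (v - p.2).
  by rewrite linearBl linearBr [RHS]addrC subrKA.
have hv1 : `|v - p.2| <= 1.
  by near: p; apply: cvgr_dist_le => //; exact: cvg_snd.
have hv : `|v - p.2| <= e / 2 / (k * `|u| + 1).
  near: p; apply: cvgr_dist_le; first exact: cvg_snd.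
  by rewrite !divr_gt0.
have hu : `|u - p.1| <= e / 2 / (k * (`|v| + 1) + 1).
  near: p; apply: cvgr_dist_le; first exact: cvg_fst.
  by rewrite !divr_gt0.
rewrite (le_trans (ler_normD _ _))// [leRHS]splitr lerD//.
  rewrite (le_trans (fk _ _))// mulrAC.
  move: hu; rewrite ler_pdivlMr// mulrC; apply: le_trans.
  rewrite ler_wpM2r// ler_wpDr// ler_wpM2l//.
  by rewrite -[p.2](subrK v) addrC (le_trans (ler_normD _ _))// lerD2l distrC.
rewrite (le_trans (fk _ _))//.
move: hv; rewrite ler_pdivlMr// mulrC; apply: le_trans.
by rewrite ler_wpM2r// ler_wpDr.
Unshelve. all: by end_near. Qed.

(** * Zero products and multipliers *)

Lemma net_tails_filter (I : Type) (le : I -> I -> Prop) :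
  directed le -> ProperFilter (net_tails le).
Proof.
move=> [[i0] le_refl le_trans le_dir]; split.
  by move=> [i /(_ _ (le_refl i))].
split; first by exists i0.
- move=> P Q [i iP] [j jQ]; have [k ik jk] := le_dir i j.
  by exists k => l kl; split; [apply: iP|apply: jQ]; apply: le_trans kl.
- by move=> P Q PQ [i iP]; exists i => j /iP/PQ.
Qed.

Section BoundedApproximateIdentity.
Context {R : realType} {A : banachAlgType R[i]}.

(** For [xi] in the dual, [xi c] is the limit of [xi (bmul c (e i))] and of
[xi (bmul (e i) c)], the values at [c] of the two actions of [e i] on [xi]. *)
Lemma dual_separating :
  has_bounded_approximate_identity A -> separating (dual A).
Proof.
move=> [I [le [e [dir _ eL eR]]]]; have FF := net_tails_filter dir.
have vanish (xi : dual A) c (h : I -> A) : h i @[i --> net_tails le] --> c ->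
    (forall i, xi (h i) = 0) -> xi c = 0.
  move=> hc h0; have : xi (h i) @[i --> net_tails le] --> xi c.
    by apply: continuous_cvg hc; exact: dual_continuous.
  under eq_cvg do rewrite h0.
  move=> /cvg_lim <-//; rewrite ?lim_cst//; exact: norm_hausdorff.
move=> xi; split=> xi0; apply: val_inj; apply/funext => c /=.
  by apply: vanish (eR c) _ => i; rewrite -dual_lactE xi0.
by apply: vanish (eL c) _ => i; rewrite -dual_ractE xi0.
Qed.

(** Currying: joint continuity of the form bounds it by a multiple of the
product of the norms, which makes the map into the dual continuous in norm. *)
Lemma continuous_partial (phi : {bilinear A -> A -> R[i]^o}) :
  continuous (fun p : A * A => phi p.1 p.2) ->
  exists2 f : {linear A -> dual A}, continuous f & forall a c, f a c = phi a c.
Proof.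
move=> /bilinear_schwarz[k k0 phik].
have fd a : phi a \in @dual_pred R A.
  apply: (@bounded_dual_pred _ _ _ (k * `|a|)) => //.
    by rewrite mulr_ge0// ltW.
  by move=> l x y; rewrite linearPr.
pose f0 a : dual A := Dual (fd a).
have f0l : linear f0.
  by move=> l x y; apply: val_inj; apply/funext => c /=; rewrite linearPl.
pose fL := GRing.isLinear.Build R[i] A (dual A) *:%R f0 f0l.
pose f : {linear A -> dual A} := HB.pack f0 fL.
exists f => //; apply: bounded_linear_continuous; apply/linear_boundedP.
near=> r => a; apply: dual_norm_le => [|x].
  by rewrite mulr_ge0//; near: r; exact: nbhs_pinfty_ge.
rewrite (le_trans (phik _ _))// !ler_wpM2r//.
by near: r; apply: nbhs_pinfty_ge; rewrite ger0_real ?ltW.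
Unshelve. all: by end_near. Qed.

(** The representing functional is the pointwise limit of [f (e i)], where
[f] is the curried form. *)
Lemma zero_product_determined_of_dual :
  has_bounded_approximate_identity A ->
  (forall f : {linear A -> dual A}, continuous f ->
    (forall a b : A, bmul a b = 0 -> ract (f a) b = 0) -> left_multiplier f) ->
  zero_product_determined A.
Proof.
move=> [I [le [e [dir [C eC] eL eR]]]] dualP phi phic phi0.
have FF := net_tails_filter dir.
have [f fc fE] := continuous_partial phic.
have fM : left_multiplier f.
  apply: dualP => // a b ab0; apply: val_inj; apply/funext => c /=.
  by rewrite fE phi0// bmulA ab0 -(scale0r a) bmulZl !scale0r.
have fab a b c : f (bmul a b) c = phi a (bmul b c).
  by rewrite fM dual_ractE fE.
have fcvg a b : f (e i) (bmul a b) @[i --> net_tails le] --> f a b.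
  under eq_cvg do rewrite fE -fab.
  apply: (@continuous_cvg _ _ _ _ _ _ (fun xi : dual A => xi b)).
    exact: dual_eval_continuous.
  by apply: continuous_cvg; [exact: fc|exact: eL].
have [k k0 fk] : exists2 k, 0 < k & forall a, `|f a| <= k * `|a|.
  by apply/pinfty_ex_gt0/linear_boundedP/continuous_linear_bounded/fc.
have [tau tauE] : exists tau : dual A,
    forall x, f (e i) x @[i --> net_tails le] --> tau x.
  apply: (@cvg_dual_of_dense _ _ _ _ _ (k * C)
    [set bmul a b | a in setT & b in setT]) => //.
  - by move=> i; rewrite (le_trans (fk _))// ler_wpM2l// ltW.
  - move=> x d d0; have [j] : exists i, `|x - bmul x (e i)| < d.
      by apply: (@filter_ex _ (net_tails le)); move/cvgrPdist_lt: (eR x); apply.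
    by exists (bmul x (e j)) => //; exists x => //; exists (e j).
  - by move=> _ [a _ [b _ <-]]; apply/cvg_ex; exists (f a b).
exists tau => a b; rewrite -fE.
by apply: cvg_unique (fcvg a b) (tauE _); exact: norm_hausdorff.
Qed.

Lemma ract_linearl (M : banachBimodType A) (a : A) :
  linear (fun m : M => ract m a).
Proof. by move=> k m n; rewrite ractDl ractZl. Qed.

Lemma ract_linearr (M : banachBimodType A) (m : M) : linear (ract m).
Proof. by move=> k a b; rewrite ractDr ractZr. Qed.

Lemma continuous_ract_form (M : banachBimodType A) (f : {linear A -> M})
    (xi : dual M) : continuous f ->
  exists2 phi : {bilinear A -> A -> R[i]^o},
    continuous (fun p : A * A => phi p.1 p.2) &
    forall a b, phi a b = xi (ract (f a) b).
Proof.
move=> fc; pose g a b : R[i]^o := xi (ract (f a) b).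
have gl : bilinear_for *:%R *:%R g.
  split=> [b k x y|a k x y]; rewrite /g.
    by rewrite linearP ract_linearl linearP.
  by rewrite ract_linearr linearP.
pose gB := bilinear_isBilinear.Build R[i] A A R[i]^o *:%R *:%R g gl.
pose phi : {bilinear A -> A -> R[i]^o} := HB.pack g gB.
exists phi => //.
have [c c0 fcb] : exists2 c, 0 < c & forall a, `|f a| <= c * `|a|.
  by apply/pinfty_ex_gt0/linear_boundedP/continuous_linear_bounded/fc.
have [k kP] := @ract_bounded _ A M.
(* The given [k] is only a complex number; its modulus bounds the action too. *)
apply: (@bounded_bilinear_continuous _ _ _ _ phi (dual_norm xi * (`|k| * c))).
  by rewrite !mulr_ge0 ?dual_norm_ge0// ltW.
move=> a b; rewrite (le_trans (le_dual_norm _ _))//.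
rewrite -!mulrA ler_wpM2l ?dual_norm_ge0//.
have := kP (f a) b => kab; rewrite (le_trans kab)//.
rewrite -(ger0_norm (le_trans (normr_ge0 _) kab)) normrM ler_wpM2l//.
by rewrite normrM !normr_id mulrA ler_wpM2r.
Qed.

(** Scalarization: each functional on [M] reduces the claim to a scalar form,
whose representation by some [tau] moves the bracket in [a b c]. *)
Lemma zero_product_determined_multiplier (M : banachBimodType A)
    (f : {linear A -> M}) :
  zero_product_determined A ->
  (forall m : M, (forall a, ract m a = 0) -> m = 0) ->
  continuous f -> (forall a b : A, bmul a b = 0 -> ract (f a) b = 0) ->
  left_multiplier f.
Proof.
move=> zpd Msep fc f0 a b; apply/eqP; rewrite -subr_eq0; apply/eqP.
apply: Msep => c; apply: dual_separates_points => xi.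
have [phi phic phiE] := continuous_ract_form xi fc.
have [|tau tauE] := zpd phi phic.
  by move=> x y xy0; rewrite phiE f0// linear0.
rewrite -scaleN1r addrC ract_linearl ractA scaleN1r addrC linearB/=.
by rewrite -!phiE !tauE bmulA subrr.
Qed.

End BoundedApproximateIdentity.

Theorem theorem2 (R : realType) (A : banachAlgType R[i])
    (hA : has_bounded_approximate_identity A) :
  [<-> (* (i) *)
       forall f : {linear A -> dual A}, continuous f ->
         (forall a b : A, bmul a b = 0 -> ract (f a) b = 0) ->
         left_multiplier f;
       (* (ii) *)
       zero_product_determined A;
       (* (iii) *)
       forall M : banachBimodType A, separating M ->
         forall f : {linear A -> M}, continuous f ->
         (forall a b : A, bmul a b = 0 -> ract (f a) b = 0) ->
         left_multiplier f].
Proof.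
tfae.
- exact: zero_product_determined_of_dual.
- move=> zpd M Msep f; apply: zero_product_determined_multiplier => // m.
  exact: (Msep m).2.
- by move=> Mmult; apply: Mmult; exact: dual_separating.
Qed.
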